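(* Let $E\in\mathbb{C}\setminus\sigma(H)$ and let $z\in\mathbb{C}$, $0<|z|<1$, be the unique point with $E=z+1/z$. Then the kernel of the resolvent $R_H(E)=(H-E)^{-1}$ is given, for $s,r\in\mathbb{Z}$, by $$[R_{H}(E)]_{s,r} = \begin{cases} -i\, u_{+}^{z}(s)\left(W(u_{-}^{1/\overline{z}}, u_{+}^{z})\right)^{-1} u_{-}^{1/\overline{z}}(r)^{*}, & s \geq r, \\[6pt] i\, u_{-}^{1/z}(s)\left(W(u_{+}^{\overline{z}}, u_{-}^{1/z})\right)^{-1} u_{+}^{\overline{z}}(r)^{*}, & s < r, \end{cases}$$ where a matrix on the right-hand side is identified with the operator of left multiplication by it on $\mathcal{M}_L$.
   Context: Fix $L\ge 1$. $\mathcal{M}_L$ is the space of complex $L\times L$ matrices with inner product $\langle A,B\rangle=\operatorname{tr}(B^*A)$. $V=(V(n))_{n\in\mathbb{Z}}$ is a sequence of self-adjoint matrices in $\mathcal{M}_L$ with $\|V\|_0:=\sum_{n}\|V(n)\|<\infty$. For $u\in\mathcal{M}_L^{\mathbb{Z}}$ put $(\tau u)(n)=u(n+1)+u(n-1)+V(n)u(n)$, and let $H$ be the restriction of $\tau$ to the Hilbert space $\ell^2(\mathbb{Z},\mathcal{M}_L)$; $H$ is bounded and self-adjoint. Its spectrum contains $[-2,2]$. Jost solutions: for $0<|\zeta|\le 1$, $\zeta\ne\pm1$, $u_+^{\zeta}\in\mathcal{M}_L^{\mathbb{Z}}$ is the solution of $\tau u=(\zeta+1/\zeta)u$ with $u_+^\zeta(n)=\zeta^n(I+o(1))$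 as $n\to+\infty$; for $|\zeta|\ge1$, $\zeta\neq\pm1$, $u_-^{\zeta}$ is the solution of $\tau u=(\zeta+1/\zeta)u$ with $u_-^\zeta(n)=\zeta^n(I+o(1))$ as $n\to-\infty$. Wronskian: $W(u,v)(n)=i\big(u(n+1)^*v(n)-u(n)^*v(n+1)\big)$. When one of $u,v$ solves $\tau u=Eu$ and the other solves $\tau v=\overline{E}v$, it does not depend on $n$ and is written $W(u,v)\in\mathcal{M}_L$. Kernel: for a bounded operator $\mathcal{K}$ on $\ell^2(\mathbb{Z},\mathcal{M}_L)$, $[\mathcal{K}]_{s,r}=\pi_s\mathcal{K}\pi_r^*\in B(\mathcal{M}_L)$, where $\pi_s(u)=u(s)$ and $(\pi_r^*A)(n)=\delta_{n,r}A$. *)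

(* Defs.v *)
From HB Require Import structures.
From mathcomp Require Import all_boot all_order all_algebra.
From mathcomp Require Import sesquilinear spectral.
From mathcomp Require Import all_classical all_reals all_analysis.
From mathcomp.real_closed Require Import complex.
From mathcomp Require Import ring lra.
Set Implicit Arguments.
Unset Strict Implicit.
Unset Printing Implicit Defensive.
Import Order.TTheory GRing.Theory Num.Theory.
Import numFieldNormedType.Exports.

(* ring_scope comes last: 'i and _^* are those of numClosedFieldType. *)
Local Open Scope classical_set_scope.
Local Open Scope sesquilinear_scope.
Local Open Scope complex_scope.
Local Open Scope ring_scope.

Section HilbertSchmidt.
Context {R : realType} {L : nat}.
Implicit Types A B : 'M[R[i]]_L.

Definition hsdot A B : R[i] := \tr (B ^t* *m A).

(* hsdot A A is real and nonnegative, so taking the real part loses nothing. *)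
Definition hsnorm A : R := Num.sqrt (complex.Re (hsdot A A)).

Lemma complex_Re_sum (I : finType) (F : I -> R[i]) :
  complex.Re (\sum_i F i) = \sum_i complex.Re (F i).
Proof. by apply: (big_morph (@complex.Re R)) => // -[a b] [c d]. Qed.

Lemma hsdotxxE A :
  complex.Re (hsdot A A) = \sum_i \sum_j Normc.normc (A j i) ^+ 2.
Proof.
rewrite /hsdot /mxtrace complex_Re_sum; apply: eq_bigr => i _.
rewrite mxE complex_Re_sum; apply: eq_bigr => j _; rewrite !mxE.
rewrite mulrC -normCK normc_def -rmorphXn /=.
by case: (A j i) => a b.
Qed.

Lemma hsdotxx_ge0 A : 0 <= complex.Re (hsdot A A).
Proof.
by rewrite hsdotxxE; apply: sumr_ge0 => i _; apply: sumr_ge0 => j _; apply: sqr_ge0.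
Qed.

Lemma hsnorm_ge0 A : 0 <= hsnorm A.
Proof. exact: sqrtr_ge0. Qed.

Lemma sqr_hsnorm A : hsnorm A ^+ 2 = \sum_i \sum_j Normc.normc (A j i) ^+ 2.
Proof. by rewrite sqr_sqrtr ?hsdotxx_ge0 // hsdotxxE. Qed.

Lemma hsnorm0 : hsnorm (0 : 'M[R[i]]_L) = 0.
Proof. by rewrite /hsnorm /hsdot mulmx0 mxtrace0 /= sqrtr0. Qed.

Lemma normc_ge0 (x : R[i]) : 0 <= Normc.normc x.
Proof. by case: x => a b; apply: sqrtr_ge0. Qed.

Lemma normc_le_hsnorm A i j : Normc.normc (A j i) <= hsnorm A.
Proof.
rewrite -(@ler_pXn2r _ 2) ?nnegrE ?normc_ge0 ?hsnorm_ge0 // sqr_hsnorm.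
rewrite (bigD1 i) //= (bigD1 j) //= -addrA lerDl addr_ge0 //.
  by apply: sumr_ge0 => k _; apply: sqr_ge0.
by apply: sumr_ge0 => k _; apply: sumr_ge0 => l _; apply: sqr_ge0.
Qed.

Lemma sqr_hsnormD A B :
  hsnorm (A + B) ^+ 2 <= 2 * (hsnorm A ^+ 2 + hsnorm B ^+ 2).
Proof.
rewrite !sqr_hsnorm -big_split /= mulr_sumr; apply: ler_sum => i _.
rewrite -big_split /= mulr_sumr; apply: ler_sum => j _; rewrite mxE.
have h : Normc.normc (A j i + B j i) ^+ 2
    <= (Normc.normc (A j i) + Normc.normc (B j i)) ^+ 2.
  by apply: lerXn2r; rewrite ?nnegrE ?addr_ge0 ?normc_ge0 ?le_normcD.
apply: (le_trans h).
by have := sqr_ge0 (Normc.normc (A j i) - Normc.normc (B j i)); nra.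
Qed.

Lemma sqr_hsnormZ a A : hsnorm (a *: A) ^+ 2 = Normc.normc a ^+ 2 * hsnorm A ^+ 2.
Proof.
rewrite !sqr_hsnorm mulr_sumr; apply: eq_bigr => i _.
by rewrite mulr_sumr; apply: eq_bigr => j _; rewrite mxE Normc.normcM exprMn.
Qed.

Lemma sqr_hsnormM A B :
  hsnorm (A *m B) ^+ 2 <= (L%:R ^+ 4) * (hsnorm A ^+ 2 * hsnorm B ^+ 2).
Proof.
rewrite sqr_hsnorm; set c := hsnorm A ^+ 2 * _.
have c0 : 0 <= hsnorm A * hsnorm B by rewrite mulr_ge0 ?hsnorm_ge0.
have h i j : Normc.normc ((A *m B) j i) ^+ 2 <= L%:R ^+ 2 * c.
  rewrite /c -!exprMn; apply: lerXn2r; rewrite ?nnegrE ?normc_ge0 ?mulr_ge0 ?hsnorm_ge0 //.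
  rewrite mxE; apply: (@le_trans _ _ (\sum_k Normc.normc (A j k * B k i))).
    elim/big_ind2 : _ => [|x1 x2 y1 y2 h1 h2|//]; first by rewrite Normc.normc0.
    by rewrite (le_trans (le_normcD _ _)) ?lerD.
  rewrite (le_trans (y := \sum_(k < L) hsnorm A * hsnorm B)) //; last first.
    by rewrite sumr_const card_ord mulr_natl.
  apply: ler_sum => k _; rewrite Normc.normcM ler_pM ?normc_ge0 //;
    exact: normc_le_hsnorm.
apply: (@le_trans _ _ (\sum_(i < L) \sum_(j < L) L%:R ^+ 2 * c)).
  by apply: ler_sum => i _; apply: ler_sum => j _; apply: h.
rewrite !sumr_const card_ord -mulrnA -[leLHS]mulr_natl natrM.
by rewrite -expr2 mulrA -exprD.
Qed.

End HilbertSchmidt.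

Section SummableReal.
Context {R : realType}.
Implicit Types f g : int -> R.

Lemma summable_le f g : (forall n, 0 <= f n <= g n) ->
  summable setT (EFin \o g) -> summable setT (EFin \o f).
Proof.
move=> fg; apply: le_lt_trans; apply: le_esum => n _ /=.
have /andP[f0 le] := fg n.
by rewrite lee_fin !ger0_norm // (le_trans f0).
Qed.

Lemma summable_scale (c : R) f : 0 <= c -> (forall n, 0 <= f n) ->
  summable setT (EFin \o f) -> summable setT (EFin \o (fun n => c * f n)).
Proof.
move=> c0 f0 sf; rewrite /summable.
apply: (@le_lt_trans _ _ (c%:E * \esum_(n in setT) `|(f n)%:E|)%E).
  apply: ge_ereal_sup => _ [X [finX _] <-].
  apply: (@le_trans _ _ (c%:E * \sum_(n \in X) `|(f n)%:E|)%E).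
    rewrite ge0_mule_fsumr; last by move=> n; apply: abse_ge0.
    by apply: lee_fsum => // n _ /=; rewrite normrM EFinM (ger0_norm c0).
  by apply: lee_wpmul2l; rewrite ?lee_fin //; apply: esum_ge; exists X.
by move: sf; rewrite summableE => /fineK <-; rewrite -EFinM ltry.
Qed.

Lemma summable_add f g : summable setT (EFin \o f) ->
  summable setT (EFin \o g) -> summable setT (EFin \o (fun n => f n + g n)).
Proof. exact: summableD. Qed.

Lemma summable_shift (k : int) f : summable setT (EFin \o f) ->
  summable setT (EFin \o (fun n => f (n + k))).
Proof.
move=> sf; rewrite /summable.
rewrite -(@reindex_esum _ _ _ setT setT (fun n => n + k)
  (fun n => `|(f n)%:E|%E)) //.
split=> // [x y _ _ /addIr //|y _].
by exists (y - k) => //; rewrite subrK.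
Qed.

Lemma summable_bounded f : summable setT (EFin \o f) ->
  exists2 M : R, 0 <= M & forall n, `|f n| <= M.
Proof.
move=> sf; exists (fine (\esum_(n in setT) `|(f n)%:E|)%E).
  by apply: fine_ge0; apply: esum_ge0.
move=> n; rewrite -lee_fin fineK; last by rewrite -[_ \is a _]summableE.
apply: esum_ge; exists [set n]; first by split.
by rewrite fsbig_set1.
Qed.

End SummableReal.

(* The Hilbert space ell^2(Z, M_L), as a subspace of the space of all
   sequences. *)
Section L2.
Context (R : realType) (L : nat).

Definition l2_pred : {pred int -> 'M[R[i]]_L} :=
  fun u => `[< summable setT (fun n : int => (hsnorm (u n) ^+ 2)%:E) >].

Record l2 := L2 { l2_val :> int -> 'M[R[i]]_L ; l2_valP : l2_val \in l2_pred }.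

Lemma l2_le (c : R) (u v : int -> 'M[R[i]]_L) : 0 <= c ->
  (forall n, hsnorm (v n) ^+ 2 <= c * hsnorm (u n) ^+ 2) ->
  u \in l2_pred -> v \in l2_pred.
Proof.
move=> c0 h /asboolP su; apply/asboolP.
apply: (@summable_le _ _ (fun n => c * hsnorm (u n) ^+ 2)).
  by move=> n; rewrite sqr_ge0 h.
by apply: summable_scale => // n; apply: sqr_ge0.
Qed.

Lemma l2D (u v : int -> 'M[R[i]]_L) :
  u \in l2_pred -> v \in l2_pred -> (fun n => u n + v n) \in l2_pred.
Proof.
move=> /asboolP su /asboolP sv; apply/asboolP.
apply: (@summable_le _ _ (fun n => 2 * (hsnorm (u n) ^+ 2 + hsnorm (v n) ^+ 2))).
  by move=> n; rewrite sqr_ge0 sqr_hsnormD.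
apply: summable_scale => //; first by move=> n; rewrite addr_ge0 ?sqr_ge0.
exact: summable_add.
Qed.

Lemma l2Z (a : R[i]) (u : int -> 'M[R[i]]_L) :
  u \in l2_pred -> (fun n => a *: u n) \in l2_pred.
Proof.
by apply: (@l2_le (Normc.normc a ^+ 2)) => [|n]; rewrite ?sqr_ge0 ?sqr_hsnormZ.
Qed.

Lemma l2_delta (r : int) (A : 'M[R[i]]_L) :
  (fun n => if n == r then A else 0) \in l2_pred.
Proof.
apply/asboolP; rewrite /summable.
apply: (@le_lt_trans _ _ (\esum_(n in [set r]) (hsnorm A ^+ 2)%:E)%E).
  rewrite [leRHS]esum_mkcond; apply: le_esum => n _ /=.
  rewrite in_set1 ger0_norm ?sqr_ge0 //.
  by case: eqP => // _; rewrite hsnorm0 expr0n.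
by rewrite esum_set1 ?ltry // lee_fin sqr_ge0.
Qed.

Lemma l2_submod_closed : submod_closed l2_pred.
Proof.
split=> [|a u v hu hv].
  rewrite (_ : 0 = fun n : int => if n == 0 then 0 else 0) ?l2_delta //.
  by apply/funext => n; case: ifP.
exact: (l2D (l2Z a hu) hv).
Qed.

HB.instance Definition _ := [isSub for l2_val].
HB.instance Definition _ := [Choice of l2 by <:].
HB.instance Definition _ :=
  GRing.isSubmodClosed.Build R[i] (int -> 'M[R[i]]_L) l2_pred l2_submod_closed.
HB.instance Definition _ := [SubChoice_isSubLmodule of l2 by <:].

Definition l2norm (u : l2) : R :=
  Num.sqrt (fine (\esum_(n in setT) (hsnorm (u n) ^+ 2)%:E)%E).

Definition bounded_operator (K : l2 -> l2) : Prop :=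
  linear K /\ exists M : R, forall u, l2norm (K u) <= M * l2norm u.

Definition is_resolvent (T : l2 -> l2) (E : R[i]) (K : l2 -> l2) : Prop :=
  [/\ bounded_operator K,
      forall u, T (K u) - E *: K u = u &
      forall u, K (T u - E *: u) = u].

Definition spectrum (T : l2 -> l2) : set R[i] :=
  ~` [set E | exists K, is_resolvent T E K].

(* (T - E)^-1; the default value 0 is only reached when E is in spectrum T. *)
Definition resolvent (T : l2 -> l2) (E : R[i]) : l2 -> l2 :=
  xget (fun=> 0) [set K | is_resolvent T E K].

Definition l2_proj (s : int) (u : l2) : 'M[R[i]]_L := u s.

(* The adjoint of l2_proj r. *)
Definition l2_inj (r : int) (A : 'M[R[i]]_L) : l2 := L2 (l2_delta r A).

Definition op_kernel (K : l2 -> l2) (s r : int) : 'M[R[i]]_L -> 'M[R[i]]_L :=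
  l2_proj s \o K \o l2_inj r.

End L2.
Arguments l2_pred {R L}.

Section Schrodinger.
Context {R : realType} {L : nat}.
Implicit Types (V u v : int -> 'M[R[i]]_L) (zeta : R[i]).

Definition summable_potential V : Prop :=
  summable setT (fun n : int => (hsnorm (V n))%:E).

Definition tau V u (n : int) : 'M[R[i]]_L := u (n + 1) + u (n - 1) + V n *m u n.

Lemma l2_tau V u : summable_potential V -> u \in l2_pred -> tau V u \in l2_pred.
Proof.
move=> sV hu; apply: l2D; last first.
  have [M M0 hM] := summable_bounded sV.
  apply: (@l2_le _ _ (L%:R ^+ 4 * M ^+ 2) _ _ _ _ hu) => [|n].
    by rewrite mulr_ge0 ?exprn_ge0.
  rewrite (le_trans (sqr_hsnormM _ _)) // -(mulrA (_ ^+ 4)) ler_wpM2l ?exprn_ge0 //.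
  rewrite ler_wpM2r ?sqr_ge0 // lerXn2r ?nnegrE ?hsnorm_ge0 //.
  by rewrite (le_trans (ler_norm _)).
move/asboolP in hu; apply: l2D; apply/asboolP.
  exact: (summable_shift 1 hu).
exact: (summable_shift (- 1) hu).
Qed.

(* The operator H: the restriction of tau to ell^2. *)
Definition schrodinger V (hV : summable_potential V) (u : l2 R L) : l2 R L :=
  L2 (l2_tau hV (l2_valP u)).

(* u(n) = zeta^n (I + o(1)) is expressed as zeta^(-n) u(n) - I --> 0. *)
Definition jost_plus V zeta u : Prop :=
  (forall n, tau V u n = (zeta + zeta^-1) *: u n) /\
  hsnorm (zeta ^ (- n%:Z) *: u n%:Z - 1%:M) @[n --> \oo] --> (0 : R).

Definition jost_minus V zeta u : Prop :=
  (forall n, tau V u n = (zeta + zeta^-1) *: u n) /\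
  hsnorm (zeta ^ n%:Z *: u (- n%:Z) - 1%:M) @[n --> \oo] --> (0 : R).

Definition wronskian u v (n : int) : 'M[R[i]]_L :=
  'i *: ((u (n + 1)) ^t* *m v n - (u n) ^t* *m v (n + 1)).

End Schrodinger.

(* Main.v *)
(** Let [g := (H - E)^-1 (delta_r A)], so that [tau g = E g + delta_r A].  To
    the right of [r], [g] is a decaying solution of [tau u = E u]; its
    Wronskian with [u_+^(z-bar)] is constant and tends to 0, hence vanishes,
    and since the Jost solutions are invertible far out this forces
    [g = u_+^z C] on [s >= r].  Now [W(u_-^(1/z-bar), g)] is 0 to the left of [r]
    and [W(u_-^(1/z-bar), u_+^z) C] to the right, and the source term makes it
    jump by [-i u_-^(1/z-bar)(r)^* A] at [r].  Taking [A = I] and [r] far enough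
    to the left, the jump is invertible, hence so is the Wronskian; for
    arbitrary [r] and [A] the identity then gives [C].  The case [s < r] follows
    by the reflection [n |-> - n]. *)

Require Import Defs.
From mathcomp Require Import all_boot all_order all_algebra.
From mathcomp Require Import sesquilinear spectral.
From mathcomp Require Import all_classical all_reals all_analysis.
From mathcomp.real_closed Require Import complex.
From mathcomp Require Import zify ring lra.
Import Order.TTheory GRing.Theory Num.Theory.
Import numFieldNormedType.Exports.
Local Open Scope classical_set_scope.
Local Open Scope sesquilinear_scope.
Local Open Scope complex_scope.
Local Open Scope ring_scope.

(** * Estimates for the Hilbert-Schmidt norm, and invertibility near the identity *)

Section MatrixNorm.
Context {R : realType} {L : nat}.
Implicit Types A B : 'M[R[i]]_L.

Lemma adjmxM A B : (A *m B) ^t* = B ^t* *m A ^t*.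
Proof. by rewrite trmx_mul map_mxM. Qed.

Lemma adjmx_unit A : (A ^t* \in unitmx) = (A \in unitmx).
Proof. by rewrite map_unitmx unitmx_tr. Qed.

Lemma hsnorm_adj A : hsnorm (A ^t*) = hsnorm A.
Proof.
rewrite /hsnorm !hsdotxxE exchange_big /=; congr Num.sqrt.
apply: eq_bigr => i _; apply: eq_bigr => j _; rewrite !mxE; congr (_ ^+ 2).
by case: (A j i) => a b; rewrite /= sqrrN.
Qed.

Lemma hsnormZ a A : hsnorm (a *: A) = Normc.normc a * hsnorm A.
Proof.
by apply/eqP; rewrite -(@eqrXn2 _ 2) ?mulr_ge0 ?hsnorm_ge0 ?normc_ge0 // exprMn sqr_hsnormZ.
Qed.

Lemma hsnormN A : hsnorm (- A) = hsnorm A.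
Proof.
rewrite -scaleN1r hsnormZ [Normc.normc _](_ : _ = 1) ?mul1r //.
by rewrite /= oppr0 sqrrN expr1n expr0n addr0 sqrtr1.
Qed.

(** The crude factor 2 comes from [2 (a^2 + b^2) <= 4 (a + b)^2]; it is harmless for limits at 0. *)
Lemma hsnormD A B : hsnorm (A + B) <= 2 * (hsnorm A + hsnorm B).
Proof.
have A0 := hsnorm_ge0 A; have B0 := hsnorm_ge0 B.
rewrite -(@ler_pXn2r _ 2) ?nnegrE ?hsnorm_ge0 ?mulr_ge0 ?addr_ge0 //.
by apply: le_trans (sqr_hsnormD _ _) _; nra.
Qed.

Lemma hsnormM A B : hsnorm (A *m B) <= L%:R ^+ 2 * (hsnorm A * hsnorm B).
Proof.
have A0 := hsnorm_ge0 A; have B0 := hsnorm_ge0 B.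
rewrite -(@ler_pXn2r _ 2) ?nnegrE ?hsnorm_ge0 ?mulr_ge0 ?exprn_ge0 //.
by apply: le_trans (sqr_hsnormM _ _) _; rewrite [leRHS]exprMn (exprMn _ (hsnorm A)) -exprM.
Qed.

Lemma hsnorm_eq0 A : hsnorm A = 0 -> A = 0.
Proof.
move=> A0; apply/matrixP => i j; rewrite mxE; apply: Normc.eq0_normc.
by apply/eqP; rewrite eq_le normc_ge0 andbT -A0 normc_le_hsnorm.
Qed.

(** The rows of [K := kermx A] span the left kernel, so [K (A - 1) = - K]; [hsnormM] then bounds the
    norm of [K] by a factor below 1 times itself, which forces [K = 0]. *)
Lemma unitmx_near1 A : L%:R ^+ 2 * hsnorm (A - 1%:M) < 1 -> A \in unitmx.
Proof.
move=> small; rewrite -row_free_unit -kermx_eq0; apply/eqP/hsnorm_eq0.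
have := hsnormM (kermx A) (A - 1%:M); have K0 := hsnorm_ge0 (kermx A).
have -> : hsnorm (kermx A *m (A - 1%:M)) = hsnorm (kermx A).
  by rewrite mulmxBr mulmx_ker mulmx1 sub0r hsnormN.
rewrite mulrCA; move: K0 small; set k := hsnorm _; set e := _ * _ => k0 e1 ke.
by apply/eqP; rewrite eq_le k0 andbT; nra.
Qed.

End MatrixNorm.

(** * Matrix sequences tending to 0 at [+oo] *)

Section Vanishing.
Context {R : realType} {L : nat}.
Implicit Types u v : nat -> 'M[R[i]]_L.

Definition vanishing u : Prop := hsnorm (u n) @[n --> \oo] --> (0 : R).

Lemma vanishing_le u (f : nat -> R) : f n @[n --> \oo] --> (0 : R) ->
  (forall n, hsnorm (u n) <= f n) -> vanishing u.
Proof.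
move=> f0 uf; apply: (squeeze_cvgr _ (cvg_cst 0) f0).
by near=> n; rewrite hsnorm_ge0 uf.
Unshelve. all: by end_near. Qed.

Lemma vanishingD u v : vanishing u -> vanishing v -> vanishing (fun n => u n + v n).
Proof.
move=> u0 v0; apply: (@vanishing_le _ (fun n => 2 * (hsnorm (u n) + hsnorm (v n)))).
  by rewrite -(mulr0 2) -(addr0 0); apply: cvgMl_tmp; apply: cvgD.
by move=> n; apply: hsnormD.
Qed.

Lemma vanishingZ a u : vanishing u -> vanishing (fun n => a *: u n).
Proof.
move=> u0; apply: (@vanishing_le _ (fun n => Normc.normc a * hsnorm (u n))).
  by rewrite -(mulr0 (Normc.normc a)); apply: cvgMl_tmp.
by move=> n; rewrite hsnormZ.
Qed.

Lemma vanishingM u v : vanishing u -> vanishing v -> vanishing (fun n => u n *m v n).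
Proof.
move=> u0 v0.
apply: (@vanishing_le _ (fun n => L%:R ^+ 2 * (hsnorm (u n) * hsnorm (v n)))).
  by rewrite -(mulr0 (L%:R ^+ 2)) -(mulr0 0); apply: cvgMl_tmp; apply: cvgM.
by move=> n; apply: hsnormM.
Qed.

Lemma vanishing_adj u : vanishing u -> vanishing (fun n => (u n) ^t*).
Proof. by move=> u0; apply: (vanishing_le _ _ u0) => n; rewrite hsnorm_adj. Qed.

Lemma vanishing_near_cst u A : vanishing u -> (\forall n \near \oo, u n = A) -> A = 0.
Proof.
move=> u0 uA; apply: hsnorm_eq0.
have : hsnorm (u n) @[n --> \oo] --> hsnorm A.
  by apply: cvg_near_cst; near=> n; congr hsnorm; near: n.
by move=> /cvg_unique; apply.
Unshelve. all: by end_near. Qed.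

End Vanishing.

Lemma summable_cvg0 {R : realType} (f : int -> R) : (forall n, 0 <= f n) ->
  summable setT (EFin \o f) -> f n%:Z @[n --> \oo] --> (0 : R).
Proof.
move=> f0 sf; apply: cvg_series_cvg_0.
have sN : summable setT (EFin \o (fun n : nat => f n%:Z)).
  apply: le_lt_trans sf.
  rewrite -(@reindex_esum _ _ _ setT (range Posz) Posz (fun n => `|(f n)%:E|%E)) //.
    rewrite [leLHS]esum_mkcond; apply: le_esum => n _ /=.
    by case: ifP => _ //=; rewrite abse_ge0.
  by split=> // x y _ _ [].
have := summable_cvg (P := xpredT) (fun n _ => f0 n%:Z : (0 <= (f n%:Z)%:E)%E).
by apply; rewrite (_ : (fun=> _) = setT) //; apply/seteqP.
Qed.

(** * Decay and eventual invertibility of Jost solutions *)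

Section JostDecay.
Context {R : realType} {L : nat}.
Implicit Types (V u : int -> 'M[R[i]]_L) (zeta : R[i]).

(** The solution is [zeta ^ n] times a bounded matrix, and [zeta ^ n] decays geometrically. *)
Lemma jost_plus_vanishing V zeta u : zeta != 0 -> `|zeta| < 1 ->
  jost_plus V zeta u -> vanishing (fun n => u n%:Z).
Proof.
move=> z0 z1 [_ u1].
apply: (vanishing_le _ (fun n : nat => Normc.normc zeta ^+ n *
   (2 * (hsnorm (zeta ^ (- n%:Z) *: u n%:Z - 1%:M) + hsnorm (1%:M : 'M[R[i]]_L))))).
  rewrite -(mul0r (2 * (0 + hsnorm (1%:M : 'M[R[i]]_L)))).
  apply: cvgM; last by apply: cvgMl_tmp; apply: cvgD => //; apply: cvg_cst.
  apply: cvg_expr; rewrite ger0_norm ?normc_ge0 // -ltcR.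
  by move: z1; rewrite normc_def; case: zeta {z0 u1}.
move=> n; have {1}-> : u n%:Z = zeta ^+ n *: ((zeta ^ (- n%:Z) *: u n%:Z - 1%:M) + 1%:M).
  by rewrite subrK scalerA -exprnN mulfV ?scale1r // expf_neq0.
have normcX : Normc.normc (zeta ^+ n) = Normc.normc zeta ^+ n.
  by elim: (n) => [|k IHk]; rewrite ?Normc.normc1 // !exprS Normc.normcM IHk.
rewrite hsnormZ normcX ler_wpM2l ?exprn_ge0 ?normc_ge0 //; exact: hsnormD.
Qed.

(** The rescaled solution tends to the identity, so [unitmx_near1] eventually applies. *)
Lemma jost_plus_unit V zeta u : zeta != 0 -> jost_plus V zeta u ->
  \forall n \near \oo, u n%:Z \in unitmx.
Proof.
move=> z0 [_ u1]; have Xn0 : L%:R ^+ 2 * hsnorm (zeta ^ (- n%:Z) *: u n%:Z - 1%:M) @[n --> \oo] --> (0 : R).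
  by rewrite -(mulr0 (L%:R ^+ 2)); apply: cvgMl_tmp.
have small := cvgr0_norm_lt _ Xn0 _ ltr01.
near=> n; have : zeta ^ (- n%:Z) *: u n%:Z \in unitmx.
  apply: unitmx_near1; apply: le_lt_trans (ler_norm _) _; near: n; exact: small.
by rewrite unitmxZ // unitfE expfz_neq0.
Unshelve. all: by end_near. Qed.

End JostDecay.

(** * Wronskian identities and uniqueness of decaying solutions *)

Section Wronskian.
Context {R : realType} {L : nat} (V : int -> 'M[R[i]]_L).
Hypothesis Vsa : forall n, V n \is hermsymmx.
Implicit Types (u v : int -> 'M[R[i]]_L) (E : R[i]).

(** Discrete Lagrange identity: eliminating [u (n - 1)] by the equation for [u], the
    self-adjointness of [V n] lets the remaining terms assemble into [tau V v n]. *)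
Lemma wronskian_jump E u v n : tau V u n = E^* *: u n ->
  wronskian u v n - wronskian u v (n - 1) =
  'i *: ((u n) ^t* *m (E *: v n - tau V v n)).
Proof.
move=> solu.
have Vn : (V n) ^t* = V n by have /is_hermitianmxP := Vsa n; rewrite scale1r.
have adj_um : (u (n - 1)) ^t* = E *: (u n) ^t* - (u (n + 1)) ^t* - (u n) ^t* *m V n.
  have -> : u (n - 1) = E^* *: u n - u (n + 1) - V n *m u n.
    by rewrite -solu /tau addrAC addrK addrAC subrr add0r.
  rewrite -{2}Vn -adjmxM; move: (V n *m u n) => Vu; apply/matrixP => i j; rewrite !mxE.
  by rewrite !rmorphB rmorphM /= conjCK.
rewrite /wronskian -scalerBr subrK adj_um /tau; congr (_ *: _).
rewrite !mulmxBl !mulmxBr !mulmxDr -scalemxAl -scalemxAr mulmxA.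
apply/matrixP => i j.
move: (u (n + 1)) (u n) (v (n + 1)) (v (n - 1)) => u1 u0 v1 v_.
rewrite !mxE; ring.
Qed.

(** Stated one-sidedly because a resolvent column has a source at [r]. The jump from [n - 1] to [n]
    uses the equation at [n] only, so [r] itself is included. *)
Lemma wronskian_cst_ge E u v r : (forall n, tau V u n = E^* *: u n) ->
  (forall n, r < n -> tau V v n = E *: v n) ->
  forall n, r <= n -> wronskian u v n = wronskian u v r.
Proof.
move=> solu solv n; rewrite -subr_ge0; set k := n - r => k0.
rewrite (_ : n = r + `|k|%:Z); last by rewrite /k; lia.
elim: `|k|%N => [|m IHm]; first by rewrite addr0.
rewrite -IHm (_ : r + m%:Z = r + m.+1%:Z - 1); last by lia.
apply/eqP; rewrite -subr_eq0.
rewrite (wronskian_jump E); last exact: solu.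
by rewrite solv; [rewrite subrr mulmx0 scaler0 | lia].
Qed.

Lemma wronskian_cst E u v m n : (forall n, tau V u n = E^* *: u n) ->
  (forall n, tau V v n = E *: v n) -> wronskian u v m = wronskian u v n.
Proof.
move=> solu solv; have le_cst k l : k <= l -> wronskian u v l = wronskian u v k.
  by apply: (wronskian_cst_ge E) => // j _; apply: solv.
by case/orP: (le_total m n) => /le_cst ->.
Qed.

Lemma wronskian_vanishing u v :
  vanishing (fun n => u n%:Z) -> vanishing (fun n => v n%:Z) ->
  vanishing (fun n => wronskian u v n%:Z).
Proof.
have shift w : vanishing (fun n => w n%:Z) -> vanishing (fun n => w (n%:Z + 1) : 'M[R[i]]_L).
  move=> w0; have w1 : hsnorm (w n.+1%:Z) @[n --> \oo] --> (0 : R).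
    by rewrite (cvg_shiftS (fun n => hsnorm (w n%:Z))).
  by apply: (vanishing_le _ _ w1) => n; rewrite -addn1.
move=> u0 v0; have u1 := shift _ u0; have v1 := shift _ v0.
apply: vanishingZ; apply: vanishingD; first exact: vanishingM (vanishing_adj _ u1) v0.
under eq_fun do rewrite -scaleN1r.
exact/vanishingZ/vanishingM/v1/vanishing_adj.
Qed.

(* The Wronskian of two decaying solutions is constant and tends to 0. *)
Lemma wronskian_vanishing_eq0 E u v r : (forall n, tau V u n = E^* *: u n) ->
  (forall n, r < n -> tau V v n = E *: v n) ->
  vanishing (fun n => u n%:Z) -> vanishing (fun n => v n%:Z) ->
  forall n, r <= n -> wronskian u v n = 0.
Proof.
move=> solu solv u0 v0 n rn; rewrite (wronskian_cst_ge E u v r) //.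
apply: vanishing_near_cst (wronskian_vanishing _ _ u0 v0) _.
near=> m; apply: (wronskian_cst_ge E) => //.
have : (`|r| <= m)%N by near: m; exact: nbhs_infty_ge.
lia.
Unshelve. all: by end_near. Qed.

Lemma tau_mulr u A n : tau V (fun n => u n *m A) n = tau V u n *m A.
Proof. by rewrite /tau !mulmxDl mulmxA. Qed.

Lemma tauB u v n : tau V (fun n => u n - v n) n = tau V u n - tau V v n.
Proof. by rewrite /tau mulmxBr !opprD [RHS]addrACA; congr (_ + _); rewrite addrACA. Qed.

Lemma wronskian_mulr u v A n :
  wronskian u (fun n => v n *m A) n = wronskian u v n *m A.
Proof. by rewrite /wronskian !mulmxA -mulmxBl scalemxAl. Qed.

Lemma wronskianB u v w n :
  wronskian u (fun n => v n - w n) n = wronskian u v n - wronskian u w n.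
Proof.
by rewrite /wronskian -scalerBr !mulmxBr !opprD [in LHS]addrACA.
Qed.

(** The three-term recurrence propagates two consecutive zeros both ways. Going down, the equation
    at a site above [r] gives the value one site lower, hence reaches [r]. *)
Lemma solution_eq0 E u r N : (forall n, r < n -> tau V u n = E *: u n) ->
  r <= N -> u N = 0 -> u (N + 1) = 0 -> forall n, r <= n -> u n = 0.
Proof.
move=> solu rN uN uN1 n rn.
have down k : r <= N - k%:Z -> u (N - k%:Z) = 0 /\ u (N - k%:Z + 1) = 0.
  elim: k => [|k IHk] rk; first by rewrite subr0.
  have [|uk uk1] := IHk; first by lia.
  rewrite (_ : N - k.+1%:Z + 1 = N - k%:Z); last by lia.
  have := solu (N - k%:Z); rewrite /tau uk uk1 mulmx0 scaler0 add0r addr0.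
  by rewrite (_ : N - k%:Z - 1 = N - k.+1%:Z); last lia; move=> ->; last lia.
have up k : u (N + k%:Z) = 0 /\ u (N + k%:Z + 1) = 0.
  elim: k => [|k [uk uk1]]; first by rewrite addr0.
  have e : N + k.+1%:Z = N + k%:Z + 1 by lia.
  have := solu (N + k%:Z + 1); rewrite /tau addrK uk uk1 mulmx0 scaler0 !addr0.
  by rewrite e => ->; last lia.
have [nN|/ltW Nn] := leP n N.
  by have := down `|N - n|%N; rewrite (_ : N - _ = n); [case|lia].
by have := up `|n - N|%N; rewrite (_ : N + _ = n); [case|lia].
Qed.

(* With [C] chosen so that [d := g - P C] vanishes at one site [N], the
   identity [W(P', d) = 0] makes it vanish at [N + 1] too. *)
Lemma vanishing_solutionE E P P' g r :
  (forall n, tau V P n = E *: P n) -> (forall n, tau V P' n = E^* *: P' n) ->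
  (forall n, r < n -> tau V g n = E *: g n) ->
  vanishing (fun n => P n%:Z) -> vanishing (fun n => P' n%:Z) ->
  vanishing (fun n => g n%:Z) ->
  (\forall n \near \oo, P n%:Z \in unitmx) ->
  (\forall n \near \oo, P' n%:Z \in unitmx) ->
  exists C, forall n, r <= n -> g n = P n *m C.
Proof.
move=> solP solP' solg P0 P'0 g0 Pu P'u.
have W0 n : r <= n -> wronskian P' g n = 0.
  exact: wronskian_vanishing_eq0.
have WP0 n : wronskian P' P n = 0.
  by apply: (wronskian_vanishing_eq0 E _ _ n).
have [N0 _ unit_ge] : \forall n \near \oo, P n%:Z \in unitmx /\ P' n%:Z \in unitmx.
  by near=> n; split; near: n.
have unitP k : (N0 <= k)%N -> P k%:Z \in unitmx /\ P' k%:Z \in unitmx by move=> /unit_ge.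
pose N := maxn N0 `|r|; have [PN P'N] : P N%:Z \in unitmx /\ P' N%:Z \in unitmx.
  by apply: unit_ge; rewrite /= leq_maxl.
have rN : r <= N%:Z by rewrite /N; lia.
pose C := invmx (P N%:Z) *m g N%:Z; pose d n := g n - P n *m C.
have sold n : r < n -> tau V d n = E *: d n.
  by move=> rn; rewrite tauB tau_mulr solg // solP scalerBr scalemxAl.
have dN : d N%:Z = 0 by rewrite /d /C mulKVmx // subrr.
have Wd : wronskian P' d N%:Z = 0.
  rewrite wronskianB wronskian_mulr.
  by rewrite W0 // WP0 mul0mx subrr.
(* As [d] vanishes at [N], only the term with [P' N] and [d (N + 1)] is left in the Wronskian, and
   the adjoint of [P' N] is invertible. *)
have dN1 : d (N%:Z + 1) = 0.
  move/eqP: Wd; rewrite /wronskian dN mulmx0 sub0r scaler_eq0 (negPf (neq0Ci _)) oppr_eq0 /=.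
  move=> /eqP /(congr1 (mulmx (invmx ((P' N%:Z) ^t* )))).
  by rewrite mulKmx ?mulmx0 // adjmx_unit.
by exists C => n rn; apply/subr0_eq; apply: (solution_eq0 E d r N%:Z).
Unshelve. all: by end_near. Qed.

End Wronskian.

(** * Reflection, and the columns of the resolvent kernel *)

Section Green.
Context {R : realType} {L : nat}.
Implicit Types (V u v : int -> 'M[R[i]]_L) (A : 'M[R[i]]_L) (z E : R[i]).

Definition reflect u : int -> 'M[R[i]]_L := fun n => u (- n).

Lemma reflectK u : reflect (reflect u) = u.
Proof. by apply/funext => n; rewrite /reflect opprK. Qed.

Lemma tau_reflect V u n : tau (reflect V) (reflect u) n = tau V u (- n).
Proof.
by rewrite /tau /reflect opprD opprB (addrC 1) (addrC (u (- n - 1))).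
Qed.

(** The reflected Wronskian pairs the sites [- n] and [- n - 1] in reverse order, whence the sign
    and the shift. *)
Lemma wronskian_reflect u v n :
  wronskian (reflect u) (reflect v) n = - wronskian u v (- n - 1).
Proof. by rewrite /wronskian /reflect subrK opprD -scalerN opprB. Qed.

(** Inverting [zeta] preserves [zeta + zeta^-1]; this transfers the results at [+oo] to [-oo]. *)
Lemma jost_minus_reflect V zeta u : jost_minus V zeta^-1 u ->
  jost_plus (reflect V) zeta (reflect u).
Proof.
move=> [sol u1]; split=> [n|].
  by rewrite tau_reflect sol invrK (addrC zeta^-1).
by move: u1; under eq_fun do rewrite exprz_inv.
Qed.

Lemma jost_eq_conj V z u : (forall n, tau V u n = (z^* + (z^*)^-1) *: u n) ->
  forall n, tau V u n = (z + z^-1)^* *: u n.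
Proof. by move=> sol n; rewrite sol rmorphD /= fmorphV. Qed.

(* Comparing the values [W(Q', g) = 0] to the left of [r] and
   [W(Q', g) = W(Q', P) C] to its right, the source at [r] fixes [C]. *)
Lemma green_column V z (P P' Q' g : int -> 'M[R[i]]_L) r A : (forall n, V n \is hermsymmx) ->
  z != 0 -> `|z| < 1 -> jost_plus V z P -> jost_plus V z^* P' ->
  (forall n, tau V Q' n = (z + z^-1)^* *: Q' n) ->
  vanishing (fun n => reflect Q' n%:Z) ->
  (forall n, tau V g n = (z + z^-1) *: g n + (if n == r then A else 0)) ->
  vanishing (fun n => g n%:Z) -> vanishing (fun n => reflect g n%:Z) ->
  exists C, (forall n, r <= n -> g n = P n *m C) /\
    (forall n, wronskian Q' P n *m C = - 'i *: ((Q' r) ^t* *m A)).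
Proof.
move=> Vsa z0 z1 jP jP' solQ' Q'0 solg g0 g_0.
have zc0 : z^* != 0 by rewrite conjC_eq0.
have zc1 : `|z^*| < 1 by rewrite norm_conjC.
have solP := proj1 jP; have solP' := jost_eq_conj _ _ _ (proj1 jP').
have solg_gt n : r < n -> tau V g n = (z + z^-1) *: g n.
  by move=> rn; rewrite solg (gt_eqF rn) addr0.
have [C gE] : exists C, forall n, r <= n -> g n = P n *m C.
  apply: (vanishing_solutionE V Vsa (z + z^-1) P P') => //.
  - exact: (jost_plus_vanishing V z).
  - exact: (jost_plus_vanishing V z^* ).
  - exact: (jost_plus_unit V z).
  - exact: (jost_plus_unit V z^* ).
exists C; split=> // n.
rewrite (wronskian_cst V Vsa (z + z^-1) _ _ _ r solQ' solP) -wronskian_mulr.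
(* After reflection the sites left of [r] lie right of [- r], and the Wronskian at [- r] is minus
   the original one at [r - 1]. *)
have left0 : wronskian Q' g (r - 1) = 0.
  have VsaN m : reflect V m \is hermsymmx by exact: Vsa.
  have := wronskian_vanishing_eq0 _ VsaN (z + z^-1) (reflect Q') (reflect g) (- r).
  move=> /(_ _ _ Q'0 g_0 (- r) (lexx _)).
  rewrite wronskian_reflect opprK => H; apply/eqP; rewrite -oppr_eq0 H // => m.
    by rewrite tau_reflect solQ'.
  by rewrite ltrNl tau_reflect solg => /lt_eqF ->; rewrite addr0.
(* Only the sites [r] and [r + 1] enter, where [g = P C]. *)
have -> : wronskian Q' (fun n => P n *m C) r = wronskian Q' g r.
  by rewrite /wronskian !gE //; lia.
rewrite -[LHS]subr0 -left0 (wronskian_jump V Vsa (z + z^-1)) // solg eqxx.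
by rewrite opprD addNKr mulmxN scalerN scaleNr.
Qed.

End Green.

(** * Decay of square-summable sequences at both ends *)

Section L2Vanishing.
Context {R : realType} {L : nat}.

Lemma l2_vanishing (u : l2 R L) : vanishing (fun n => u n%:Z).
Proof.
have /asboolP su := l2_valP u.
have u0 := summable_cvg0 _ (fun n => sqr_ge0 (hsnorm (u n))) su.
rewrite /vanishing -(sqrtr0 R).
under eq_fun do rewrite -(ger0_norm (hsnorm_ge0 (u _))) -sqrtr_sqr.
exact: (continuous_cvg _ (@sqrt_continuous R 0) u0).
Qed.

Lemma l2_reflect (u : l2 R L) : reflect u \in l2_pred.
Proof.
have /asboolP su := l2_valP u; apply/asboolP; rewrite /summable.
by rewrite -(@reindex_esum _ _ _ setT setT -%R
  (fun n => `|(hsnorm (u n) ^+ 2)%:E|%E)).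
Qed.

End L2Vanishing.

Lemma unitmx_of_scaled_adj (R : realType) (L : nat) (W U C : 'M[R[i]]_L) (a : R[i]) :
  a != 0 -> U \in unitmx -> W *m C = a *: ((U ^t* ) *m 1%:M) -> W \in unitmx.
Proof.
move=> a0 Uu WC; have : W *m C \in unitmx.
  by rewrite WC mulmx1 unitmxZ ?unitfE // adjmx_unit.
by rewrite unitmx_mul => /andP[].
Qed.

Theorem theorem1p5 (R : realType) (L : nat) (hL : (1 <= L)%N)
    (V : int -> 'M[R[i]]_L)
    (Vsa : forall n, V n \is hermsymmx) (Vsum : summable_potential V)
    (E z : R[i]) (hE : ~ spectrum (schrodinger Vsum) E)
    (z_gt0 : 0 < `|z|) (z_lt1 : `|z| < 1) (Ez : E = z + z^-1)
    (up_z up_zc um_Vz um_Vzc : int -> 'M[R[i]]_L)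
    (h_up_z : jost_plus V z up_z)
    (h_up_zc : jost_plus V z^* up_zc)
    (h_um_Vz : jost_minus V z^-1 um_Vz)
    (h_um_Vzc : jost_minus V (z^*)^-1 um_Vzc)
    (n s r : int) :
  [/\ wronskian um_Vzc up_z n \in unitmx,
      wronskian up_zc um_Vz n \in unitmx &
      op_kernel (resolvent (schrodinger Vsum) E) s r =
      mulmx (if r <= s
             then - 'i *: (up_z s *m invmx (wronskian um_Vzc up_z n)
                             *m (um_Vzc r) ^t*)
             else 'i *: (um_Vz s *m invmx (wronskian up_zc um_Vz n)
                           *m (up_zc r) ^t*))].
Proof.
have z0 : z != 0 by rewrite -normr_gt0.
have zc0 : z^* != 0 by rewrite conjC_eq0.
have zc1 : `|z^*| < 1 by rewrite norm_conjC.
set K := resolvent _ _.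
(* Off the spectrum an inverse exists, so [xget] does not return its default 0. *)
have [_ KE _] : is_resolvent (schrodinger Vsum) E K.
  by apply: xgetPex; apply: contrapT.
have sol_g q A m : tau V (K (l2_inj q A)) m =
    (z + z^-1) *: K (l2_inj q A) m + (if m == q then A else 0).
  have /(congr1 (fun w : l2 R L => w m)) /= := KE (l2_inj q A).
  by rewrite -Ez => <-; rewrite addrC subrK.
have VsaN m : reflect V m \is hermsymmx by exact: Vsa.
have jQ := jost_minus_reflect _ _ _ h_um_Vz.
have jQ' := jost_minus_reflect _ _ _ h_um_Vzc.
have solP' := jost_eq_conj _ _ _ (proj1 h_up_zc).
have solQ' : forall m, tau V um_Vzc m = (z + z^-1)^* *: um_Vzc m.
  by apply: jost_eq_conj => m; rewrite (proj1 h_um_Vzc) invrK addrC.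
have right q A : exists C, (forall m, q <= m -> K (l2_inj q A) m = up_z m *m C) /\
    wronskian um_Vzc up_z n *m C = - 'i *: ((um_Vzc q) ^t* *m A).
  have [||C [gC WC]] := green_column V z up_z up_zc um_Vzc (K (l2_inj q A)) q A
    Vsa z0 z_lt1 h_up_z h_up_zc solQ' _ (sol_g q A) (l2_vanishing _).
  - exact: (jost_plus_vanishing _ _ _ zc0 zc1 jQ').
  - exact: (l2_vanishing (L2 (l2_reflect _))).
  by exists C.
(* Apply [green_column] to the reflected potential with source at [- q]: reflection exchanges the
   roles of the plus and minus solutions. *)
have left q A : exists D, (forall m, m <= q -> K (l2_inj q A) m = um_Vz m *m D) /\
    wronskian up_zc um_Vz n *m D = 'i *: ((up_zc q) ^t* *m A).
  have [|||||D [gD WD]] := green_column (reflect V) z (reflect um_Vz) (reflect um_Vzc)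
    (reflect up_zc) (reflect (K (l2_inj q A))) (- q) A VsaN z0 z_lt1 jQ jQ'.
  - by move=> m; rewrite tau_reflect solP'.
  - by rewrite reflectK; exact: (jost_plus_vanishing _ _ _ zc0 zc1 h_up_zc).
  - by move=> m; rewrite tau_reflect sol_g eqr_oppLR.
  - exact: (l2_vanishing (L2 (l2_reflect _))).
  - by rewrite reflectK; exact: l2_vanishing.
  exists D; split=> [m mq|].
    by have := gD (- m); rewrite lerN2 /reflect opprK; apply.
  (* The reflected Wronskian at [- n - 1] is minus the original one at [n], which turns [- 'i] into
     ['i]. *)
  have := WD (- n - 1); rewrite wronskian_reflect /reflect opprK.
  rewrite opprD opprK opprK addrK mulNmx scaleNr => /oppr_inj; exact.
(* Invertibility makes [invmx] a genuine inverse. The source [1%:M] sits at [- k], where [um_Vzc] is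
   invertible. *)
have W1u : wronskian um_Vzc up_z n \in unitmx.
  have [k _ /(_ k (leqnn _)) Uk] := jost_plus_unit _ _ _ zc0 jQ'.
  have [C [_ WC]] := right (- k%:Z) 1%:M.
  by apply: unitmx_of_scaled_adj WC; rewrite // oppr_eq0 neq0Ci.
(* Here the source sits far to the right, where [up_zc] is invertible. *)
have W2u : wronskian up_zc um_Vz n \in unitmx.
  have [k _ /(_ k (leqnn _)) Uk] := jost_plus_unit _ _ _ zc0 h_up_zc.
  have [D [_ WD]] := left k%:Z 1%:M.
  by apply: unitmx_of_scaled_adj WD; rewrite // neq0Ci.
split=> //; apply/funext => A; rewrite /op_kernel /= /l2_proj.
case: leP => [rs|/ltW sr].
  have [C [-> // WC]] := right r A.
  by rewrite -[C](mulKmx W1u) WC -!scalemxAr -scalemxAl !mulmxA.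
have [D [-> // WD]] := left r A.
by rewrite -[D](mulKmx W2u) WD -!scalemxAr -scalemxAl !mulmxA.
Qed.
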